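(* Let $T:\mathbb{R}^n\to\mathbb{R}^n$ be a bounded (possibly nonlinear) operator and let $$g(x)=\operatorname{sign}(\langle x,T(x)\rangle)\,\frac{T(x)}{\|T(x)\|}$$ for $x$ in the set $D=\{x\in\mathbb{R}^n:\langle x,T(x)\rangle\neq 0\}$ on which this expression is well defined. Let $f^0\in\mathbb{R}^n$ with $\|f^0\|=1$, and let $u^0=f^0$, $u^{k+1}=g(u^k)$ for $k\ge 0$, where it is assumed that all iterates $u^k$ lie in $D$. If $g$ is a contraction operator, that is, if there exists $L<1$ such that $\|g(x)-g(y)\|\le L\|x-y\|$ for all $x,y\in D$, then the fixed-point iteration converges in the sense that $$\lim_{k\to\infty}\|u^k-u^{k-1}\|=0.$$
   Context: $\langle\cdot,\cdot\rangle$ is the Euclidean inner product on $\mathbb{R}^n$ and $\|\cdot\|$ is the $\ell^2$-norm. The sequence $\{u^k\}$ is the power iteration of $T$ written as a fixed-point process for $g$; the stopping criterion of the numerical algorithm is disregarded. Standing assumption: for all $k$, $0<\|T(u^k)\|<\infty$ and $\langle u^k,T(u^k)\rangle\neq 0$. *)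

(* Defs.v *)
From HB Require Import structures.
From mathcomp Require Import all_boot all_order all_algebra.
From mathcomp Require Import all_classical all_reals all_analysis.

Set Implicit Arguments.
Unset Strict Implicit.
Unset Printing Implicit Defensive.

Import Order.TTheory GRing.Theory Num.Theory.
Import numFieldNormedType.Exports.

Local Open Scope classical_set_scope.
Local Open Scope ring_scope.

Definition dotp (R : realType) (n : nat) (x y : 'rV[R]_n) : R :=
  \sum_(i < n) x 0 i * y 0 i.

(* The canonical norm `|x| on 'rV[R]_n is the sup norm, hence this definition. *)
Definition l2norm (R : realType) (n : nat) (x : 'rV[R]_n) : R :=
  Num.sqrt (dotp x x).

(* Boundedness of a nonlinear operator: bounded sets are sent to bounded sets,
   as in bounded_fun_norm but for the Euclidean norm. *)
Definition bounded_operator (R : realType) (n : nat)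
    (T : 'rV[R]_n -> 'rV[R]_n) : Prop :=
  forall r : R, exists M : R,
    forall x : 'rV[R]_n, l2norm x <= r -> l2norm (T x) <= M.

(* By Cauchy-Schwarz, T x != 0 on this set, so the quotient in power_map makes
   sense there. *)
Definition power_dom (R : realType) (n : nat) (T : 'rV[R]_n -> 'rV[R]_n) :
    set 'rV[R]_n :=
  [set x | dotp x (T x) != 0].

(* Meaningful on power_dom T only; elsewhere the sign is 0 and so is the
   value. *)
Definition power_map (R : realType) (n : nat) (T : 'rV[R]_n -> 'rV[R]_n)
    (x : 'rV[R]_n) : 'rV[R]_n :=
  (Num.sg (dotp x (T x)) / l2norm (T x)) *: T x.

(* g is not required to map D into itself. *)
Definition contraction_on (R : realType) (n : nat) (D : set 'rV[R]_n)
    (g : 'rV[R]_n -> 'rV[R]_n) : Prop :=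
  exists L : R, L < 1 /\
    forall x y : 'rV[R]_n, D x -> D y ->
      l2norm (g x - g y) <= L * l2norm (x - y).

(* Main.v *)
Require Import Defs.
From mathcomp Require Import all_boot all_order all_algebra.
From mathcomp Require Import all_classical all_reals all_analysis.
Import Order.TTheory GRing.Theory Num.Theory.
Import numFieldNormedType.Exports.
Local Open Scope classical_set_scope.
Local Open Scope ring_scope.

(** All iterates lie in [power_dom T], so the contraction bound applies to each pair of consecutive
    ones: every step length is at most a fixed ratio below 1 times the previous one. The step
    lengths are thus squeezed between 0 and a geometric sequence tending to 0. *)

Theorem proposition5 (R : realType) (n : nat) (T : 'rV[R]_n -> 'rV[R]_n)
    (T_bounded : bounded_operator T)
    (f0 : 'rV[R]_n) (f0_unit : l2norm f0 = 1)
    (u : nat -> 'rV[R]_n)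
    (u_init : u 0%N = f0)
    (u_step : forall k : nat, u k.+1 = power_map T (u k))
    (u_dom : forall k : nat, power_dom T (u k))
    (g_contraction : contraction_on (power_dom T) (power_map T)) :
  l2norm (u k.+1 - u k) @[k --> \oo] --> (0 : R).
Proof.
have [L [L_lt1 gL]] := g_contraction.
(* L may be negative, so Num.max L 0 is the ratio of the geometric bound. *)
set q := Num.max L 0; set d := fun k => l2norm (u k.+1 - u k).
have q_ge0 : 0 <= q by rewrite le_max lexx orbT.
have q_lt1 : q < 1 by rewrite gt_max L_lt1 ltr01.
have d_ge0 k : 0 <= d k by exact: sqrtr_ge0.
have d_step k : d k.+1 <= q * d k.
  (* Only the left-hand difference becomes one of values of [power_map T]; the right-hand one stays
     [d k]. *)
  rewrite /d (u_step k.+1) [X in _ - X]u_step.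
  apply: (le_trans (gL _ _ (u_dom _) (u_dom _))).
  by apply: ler_wpM2r; [exact: d_ge0 | rewrite le_max lexx].
have d_geo k : d k <= geometric (d 0%N) q k.
  elim: k => [|k IHk] /=; first by rewrite expr0 mulr1.
  apply: (le_trans (d_step k)).
  (* One factor [q] is moved to the front to match [q * d k]. *)
  by rewrite exprS mulrCA; apply: ler_wpM2l.
apply: (@squeeze_cvgr _ _ _ _ (fun=> 0) (geometric (d 0%N) q)).
- by near=> k; rewrite d_ge0 d_geo.
- exact: cvg_cst.
- by apply: cvg_geometric; rewrite ger0_norm.
Unshelve. all: by end_near. Qed.
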